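(* Let $n\ge 4$ be an even integer and let $\mathscr{A}$ and $\mathscr{B}$ be two antichains of $\mathbb{N}_n=\{1,\dots,n\}$. Suppose that for some integer $k\le \min\{|\mathscr{A}|,|\mathscr{B}|\}$ the members can be enumerated as $\mathscr{A}=\{A_1,A_2,\dots\}$, $\mathscr{B}=\{B_1,B_2,\dots\}$ so that for all $A_i\in\mathscr{A}$, $B_j\in\mathscr{B}$, $A_i\cap B_j=\emptyset$ only if $i=j\le k$ (i.e. there are at most $k$ non-intersecting pairs). Then $$|\mathscr{A}|+|\mathscr{B}|\le \binom{n}{n/2}+\binom{n}{n/2+1}-\kappa^*_{n/2}(k),$$ where $\kappa^*_{n/2}(k)=0$ if $k<1+\sum_{i=1}^{n/2}\binom{2i-1}{i}$ and $\kappa^*_{n/2}(k)<0$ otherwise. Furthermore, equality holds if (i) $k<1+\sum_{i=1}^{n/2}\binom{2i-1}{i}$, $\mathscr{A}=\binom{\mathbb{N}_n}{n/2}$ and $\mathscr{B}=\binom{\mathbb{N}_n}{n/2+1}$; or (ii) $k\ge 1+\sum_{i=1}^{n/2}\binom{2i-1}{i}$, $\mathscr{A}=\binom{\mathbb{N}_n}{n/2}$ and $\mathscr{B}=L_{n,n/2}(m)\cup\Big(\binom{\mathbb{N}_n}{n/2+1}\setminus\nabla L_{n,n/2}(m)\Big)$, where $m\le k$ is an integer such that $\kappa^*_{n/2}(k)=\kappa_{n/2}(m)$.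
   Context: An antichain of $\mathbb{N}_n$ is a family of subsets no member of which is contained in another. $\binom{\mathbb{N}_n}{r}$ denotes the family of all $r$-subsets of $\mathbb{N}_n$. For a family $\mathscr{F}$ of $r$-sets, its shadow is $\Delta\mathscr{F}=\{X:|X|=r-1, X\subset Y \text{ for some } Y\in\mathscr{F}\}$ and its shade is $\nabla\mathscr{F}=\{X\subseteq\mathbb{N}_n:|X|=r+1, Y\subset X\text{ for some }Y\in\mathscr{F}\}$. Squashed order on $r$-subsets: $A<_s B$ if $A\ne B$ and the largest element of the symmetric difference $(A\setminus B)\cup(B\setminus A)$ lies in $B$. $F_{n,r}(m)$ (resp. $L_{n,r}(m)$) denotes the family of the first (resp. last) $m$ $r$-subsets of $\mathbb{N}_n$ in squashed order. Every nonnegative integer $m$ has a unique $r$-binomial representation $m=\sum_{i=t}^{r}\binom{a_i}{i}$ with $a_r>a_{r-1}>\dots>a_t\ge t\ge 1$ (empty sum for $m=0$). The Kruskal–Katona function is $\kappa_r(m):=\sum_{i=t}^{r}\binom{a_i}{i-1}-m$, which equals $|\Delta F_{n,r}(m)|-m$ whenever $m\le\binom{n}{r}$; and $\kappa^*_r(m):=\min_{0\le j\le m}\kappa_r(j)$. *)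

(* Defs.v *)
From mathcomp Require Import all_boot all_order all_algebra zify.
Set Implicit Arguments.
Unset Strict Implicit.
Unset Printing Implicit Defensive.
Import Order.TTheory GRing.Theory Num.Theory.

(* The ground set {1, ..., n} is represented by 'I_n = {0, ..., n - 1}; the
   shift by one preserves the order of the elements, which is all that the
   squashed order depends on. *)

Definition antichain (T : finType) (F : {set {set T}}) : Prop :=
  {in F &, forall X Y : {set T}, X \subset Y -> X = Y}.

Definition rsubsets (n r : nat) : {set {set 'I_n}} :=
  [set X : {set 'I_n} | #|X| == r].

(* F is meant to consist of r-sets. *)
Definition shade (n r : nat) (F : {set {set 'I_n}}) : {set {set 'I_n}} :=
  [set X : {set 'I_n} | (#|X| == r.+1) && [exists Y in F, Y \subset X]].

Definition symdiff (T : finType) (X Y : {set T}) : {set T} :=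
  (X :\: Y) :|: (Y :\: X).

(* The largest element of the symmetric difference lies in Y; its existence
   forces X != Y. *)
Definition squashed_lt (n : nat) (X Y : {set 'I_n}) : bool :=
  [exists x in symdiff X Y,
     (x \in Y) && [forall y in symdiff X Y, (y <= x)%N]].

(* L_{n,r}(m): an r-set is among the last m ones in squashed order iff fewer
   than m r-sets come strictly after it. *)
Definition last_rsubsets (n r m : nat) : {set {set 'I_n}} :=
  [set X in rsubsets n r | #|[set Y in rsubsets n r | squashed_lt X Y]| < m].

(* With indices starting at 0: the members of A and of B can be listed without
   repetition so that the i-th member of A and the j-th member of B are
   disjoint only if i = j < k. *)
Definition disjoint_only_on_diagonal (T : finType) (k : nat)
    (A B : {set {set T}}) : Prop :=
  exists sA sB : seq {set T},
    [/\ uniq sA, sA =i A, uniq sB, sB =i B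
      & forall i j : nat, i < size sA -> j < size sB ->
          [disjoint nth set0 sA i & nth set0 sB j] -> i = j /\ i < k].

(* s = [:: a_r; a_{r-1}; ...; a_t] is an r-binomial representation of m. Here
   t = r + 1 - size s, and the default value of last makes the condition
   a_t >= t vacuous for the empty sequence, which represents 0. *)
Definition is_binrep (r m : nat) (s : seq nat) : Prop :=
  [/\ size s <= r,
      sorted gtn s,
      r.+1 - size s <= last r.+1 s
    & m = \sum_(j < size s) 'C(nth 0 s j, r - j)].

(* The largest a such that 'C(a, r) <= m (for r > 0 any such a is smaller
   than m + r). *)
Definition bintop (r m : nat) : nat :=
  \max_(a < m + r | 'C(a, r) <= m) a.

Fixpoint binrep (r m : nat) : seq nat :=
  match r, m with
  | r'.+1, m'.+1 =>
      let a := bintop r m in a :: binrep r' (m - 'C(a, r))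
  | _, _ => [::]
  end.

Lemma bintop_le (r m : nat) : 0 < r -> 'C(bintop r m, r) <= m.
Proof.
rewrite /bintop => r0.
elim/big_ind: _ => [|x y hx hy|i //]; first by rewrite bin0n gtn_eqF.
by case: (leqP x y).
Qed.

Lemma ltn_bin_add (r m : nat) : 0 < r -> m < 'C(m + r, r).
Proof.
case: r => // r _; elim: m => [|m IH]; first by rewrite add0n binn.
have : 0 < 'C(m + r.+1, r) by rewrite bin_gt0; lia.
by rewrite addSn binS; lia.
Qed.

Lemma bintop_gt (r m : nat) : 0 < r -> m < 'C((bintop r m).+1, r).
Proof.
move=> r0; rewrite ltnNge; apply/negP => h.
have lt : (bintop r m).+1 < m + r.
  rewrite ltnNge; apply/negP => /(leq_bin2l r) h2.
  by have := ltn_bin_add m r0; lia.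
have := @leq_bigmax_cond _ (fun a : 'I_(m + r) => 'C(a, r) <= m) val
  (Ordinal lt) h.
by rewrite -/(bintop r m) /= ltnn.
Qed.

Lemma bintopE (r m a : nat) :
  0 < r -> 'C(a, r) <= m < 'C(a.+1, r) -> a = bintop r m.
Proof.
move=> r0 /andP[h1 h2].
have h3 := bintop_le m r0; have h4 := bintop_gt m r0.
by case: (ltngtP a (bintop r m)) => // /(leq_bin2l r); lia.
Qed.

Lemma binsum_cons (r a : nat) (s : seq nat) :
  \sum_(j < size (a :: s)) 'C(nth 0 (a :: s) j, r.+1 - j) =
  'C(a, r.+1) + \sum_(j < size s) 'C(nth 0 s j, r - j).
Proof. by rewrite /= big_ord_recl. Qed.

Lemma binsum_lt (r a : nat) (s : seq nat) :
  size s <= r -> path gtn a s -> r.+1 - size s <= last a s ->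
  \sum_(j < size s) 'C(nth 0 s j, r - j) < 'C(a, r).
Proof.
elim: s r a => [|b s IH] r a.
  by move=> _ _ /= h; rewrite big_ord0 bin_gt0; lia.
case: r => // r sz /andP[/= ba ps] ls; rewrite binsum_cons.
have := IH r b sz ps ls; have := leq_bin2l r.+1 ba.
by rewrite binS; lia.
Qed.

Lemma path_gtn_last (a : nat) (s : seq nat) :
  path gtn a s -> last a s + size s <= a.
Proof.
by elim: s a => [|b s IH] a /=; [lia | move=> /andP[ba /IH]; lia].
Qed.

Lemma binrep_unique (r m : nat) (s : seq nat) :
  is_binrep r m s -> s = binrep r m.
Proof.
elim: s r m => [|a s IH] r m [sz srt ls mE].
  by move: mE; rewrite big_ord0 => ->; case: r {sz ls}.
case: r sz ls mE => // r sz ls; rewrite binsum_cons => mE.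
have h := @binsum_lt r a s sz srt ls.
have aE : a = bintop r.+1 m.
  by apply: bintopE => //; rewrite binS; lia.
have m0 : 0 < m.
  have := path_gtn_last srt; have := bin_gt0 a r.+1.
  by move: ls sz => /=; lia.
case: m m0 mE aE => // m _ mE aE.
rewrite [binrep _ _]/= -aE; congr (_ :: _); apply: IH; split.
- exact: sz.
- exact: path_sorted srt.
- by case: (s) ls => //=; lia.
- by rewrite mE addKn.
Qed.

Lemma binrep_correct (r m : nat) : 0 < r -> is_binrep r m (binrep r m).
Proof.
case: r => // r _; elim: r m => [|r IH] [|m].
- by split=> //=; rewrite big_ord0.
- have h1 := @bintop_le 1 m.+1 isT; have h2 := @bintop_gt 1 m.+1 isT.
  rewrite !bin1 in h1 h2; rewrite [binrep _ _]/=; split=> //=; first by lia.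
  by rewrite big_ord1 /= bin1; lia.
- by split=> //=; rewrite big_ord0.
have h1 := @bintop_le r.+2 m.+1 isT; have h2 := @bintop_gt r.+2 m.+1 isT.
have a_ge : r.+2 <= bintop r.+2 m.+1.
  rewrite leqNgt; apply/negP => lt.
  by have := leq_bin2l r.+2 lt; rewrite binn; lia.
have -> : binrep r.+2 m.+1 =
  bintop r.+2 m.+1 :: binrep r.+1 (m.+1 - 'C(bintop r.+2 m.+1, r.+2)) by [].
set a := bintop _ _ in h1 h2 a_ge *; set m' := _ - _.
have m'lt : m' < 'C(a, r.+1) by move: h2; rewrite binS /m'; lia.
have := IH m'; case: (binrep r.+1 m') => [|b s] [sz srt ls mE].
  by split=> //; rewrite binsum_cons -mE /m'; lia.
have ba : b < a.
  rewrite ltnNge; apply/negP => /(leq_bin2l r.+1).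
  by move: mE; rewrite binsum_cons; lia.
split=> //; last by rewrite binsum_cons -mE /m'; lia.
by apply/andP; split.
Qed.

Local Open Scope ring_scope.

(* The Kruskal-Katona function; the j-th entry of s is a_i with i = r - j. *)
Definition kappa (r m : nat) : int :=
  let s := binrep r m in
  (\sum_(j < size s) 'C(nth 0 s j, (r - j).-1))%N%:Z - m%:Z.

Definition kappa_star (r m : nat) : int :=
  \big[Num.min/kappa r 0]_(j < m.+1) kappa r j.

(* Main.v *)
(* Put n = 2h and C = { ~: Y | Y in B }, so that a disjoint pair (X, Y) becomes
   an inclusion of X in ~: Y.  Exchanging the members of A and of C in the at
   most k inclusions, one may assume that they are equalities, i.e. members of
   the intersection of A and C.  Since shadows above the middle level do not shrink, the
   members of A of size > h and <= h can be replaced by families U of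
   (h+1)-sets and Z of h-sets, and those of C of size >= h and < h by families
   W of h-sets and V of (h-1)-sets.  Then Z avoids the shadow of U, W avoids
   the shade of V, and Z and W have at most k common members.  Counting, it
   remains to bound f(Q1') + f(Q2), where f(Q) = |Q| - |shadow Q|, Q1' consists
   of the complements of the h-sets outside the shadow of U, and Q2 of the h-sets
   outside the shade of V.  As f is supermodular and invariant under permutations
   of the ground set, (Q1', Q2) can be uncrossed until one family is the whole
   layer or the other one is empty; the Kruskal-Katona theorem bounds what is
   left.

   The same uncrossing proves the numerical inequalities (subadditivity and
   K T + K (x + y - T) <= K x + K y for x, y <= T = 'C(a, r)) which yield, by
   induction on r, the Eckhoff-Wegner inequality
   K_r (m0 + m1) <= max (K_r m0) m1 + K_(r-1) m1, hence Kruskal-Katona without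
   shifting: split a family according to whether a set contains a fixed point. *)
Require Import Defs.
From mathcomp Require Import all_boot all_order all_algebra perm zify.
Set Implicit Arguments.
Unset Strict Implicit.
Unset Printing Implicit Defensive.
Import Order.TTheory GRing.Theory Num.Theory.

(* [kappa r m] is [kk r m - m]. *)
Definition kk (r m : nat) : nat :=
  \sum_(j < size (binrep r m)) 'C(nth 0 (binrep r m) j, (r - j).-1).

(** * Recursion for the size of the extremal shadow *)

Lemma kk0n m : kk 0 m = 0.
Proof. by rewrite /kk big_ord0. Qed.

Lemma kkn0 r : kk r 0 = 0.
Proof. by rewrite /kk; case: r => [|r]; rewrite big_ord0. Qed.

(** By Pascal's rule [x < 'C(a, r)] makes [a] the top entry of the representation; the remaining
    entries represent [x] one level down. *)
Lemma kk_cascade_lt r a x :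
  x < 'C(a, r) -> 0 < 'C(a, r.+1) + x ->
  kk r.+1 ('C(a, r.+1) + x) = 'C(a, r) + kk r x.
Proof.
move=> x_lt m_gt0.
have -> : kk r.+1 ('C(a, r.+1) + x) =
    \sum_(j < size (a :: binrep r x)) 'C(nth 0 (a :: binrep r x) j, (r.+1 - j).-1).
  have top : a = bintop r.+1 ('C(a, r.+1) + x) by apply: bintopE => //; rewrite binS; lia.
  suff e : binrep r.+1 ('C(a, r.+1) + x) = a :: binrep r x by rewrite /kk e.
  case mE: ('C(a, r.+1) + x) m_gt0 => [//|m] _.
  by rewrite [LHS]/= -mE -top addKn.
by rewrite big_ord_recl.
Qed.

Lemma kk_bin r a : r < a -> kk r.+1 'C(a, r.+1) = 'C(a, r).
Proof.
move=> ra; rewrite -[in LHS](addn0 'C(a, r.+1)) kk_cascade_lt ?kkn0 ?addn0 //.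
  by rewrite bin_gt0 ltnW.
by rewrite bin_gt0.
Qed.

(** At the endpoint [x = 'C(a, r)] the representation itself changes, as the sum is
    ['C(a.+1, r.+1)], but Pascal's rule yields the same value. The closed range spares later
    arguments any carry. *)
Lemma kk_cascade r a x :
  x <= 'C(a, r) -> 0 < 'C(a, r.+1) + x ->
  kk r.+1 ('C(a, r.+1) + x) = 'C(a, r) + kk r x.
Proof.
rewrite leq_eqVlt => /orP[/eqP ->|]; last exact: kk_cascade_lt.
rewrite -binS bin_gt0 => ra; rewrite kk_bin //.
case: r ra => [|r] ra; first by rewrite kk0n !bin0.
by rewrite binS kk_bin.
Qed.

Lemma bin_decomp r m : 0 < m ->
  exists a x, [/\ r < a, m = 'C(a, r.+1) + x & x < 'C(a, r)].
Proof.
move=> m0; have h1 := @bintop_le r.+1 m isT; have h2 := @bintop_gt r.+1 m isT.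
exists (bintop r.+1 m), (m - 'C(bintop r.+1 m, r.+1)).
set a := bintop _ _ in h1 h2 *; split; last by move: h1 h2; clearbody a; rewrite binS; lia.
  rewrite ltnNge; apply/negP => /(@leq_bin2l a.+1 r.+1 r.+1).
  by move=> ar; have := leq_trans h2 ar; rewrite binn; lia.
by rewrite subnKC.
Qed.

Lemma kk_mono r : {homo kk r : m m' / m <= m'}.
Proof.
apply: (@homo_leq _ (kk r) leq) => //; first exact: leq_trans.
elim: r => [|r IH] m; first by rewrite !kk0n.
case: (posnP m) => [->|m0]; first by rewrite kkn0.
have [a [x [ra -> xlt]]] := bin_decomp r m0.
have a0 : 0 < 'C(a, r.+1) by rewrite bin_gt0.
(* The extra unit goes into the remainder; since [x < 'C(a, r)], the cascade still applies to
   [x.+1]. *)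
by rewrite -addnS !kk_cascade ?leq_add2l ?IH //; lia.
Qed.

(** * Shadows *)

Section Shadow.
Variable T : finType.
Implicit Types (X Y : {set T}) (F G Q : {set {set T}}) (r : nat).

Definition layer r : {set {set T}} := [set X : {set T} | #|X| == r].

(** No level is mentioned, so one operator serves all layers; on families of [r]-sets it is the
    usual shadow. *)
Definition shadow F : {set {set T}} :=
  [set Y : {set T} | [exists x, (x \notin Y) && (x |: Y \in F)]].

Definition co F : {set {set T}} := [set X : {set T} | ~: X \in F].

Definition del (e : T) F : {set {set T}} := [set X : {set T} in F | e \notin X].
Definition link (e : T) F : {set {set T}} := [set X : {set T} | (e \notin X) && (e |: X \in F)].

Lemma shadowP F Y :
  reflect (exists2 x, x \notin Y & x |: Y \in F) (Y \in shadow F).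
Proof.
rewrite inE; apply: (iffP existsP) => [[x /andP[]]|[x xY YF]]; first by exists x.
by exists x; rewrite xY.
Qed.

Lemma shadow0 : shadow set0 = set0.
Proof. by apply/setP => Y; rewrite in_set0; apply/negbTE/shadowP => -[x _]; rewrite in_set0. Qed.

Lemma shadowS F G : F \subset G -> shadow F \subset shadow G.
Proof.
by move/subsetP=> FG; apply/subsetP => Y /shadowP[x xY /FG h]; apply/shadowP; exists x.
Qed.

Lemma shadowU F G : shadow (F :|: G) = shadow F :|: shadow G.
Proof.
apply/eqP; rewrite eqEsubset subUset !shadowS ?subsetUl ?subsetUr // !andbT.
apply/subsetP => Y /shadowP[x xY]; rewrite !in_setU => /orP[h|h]; apply/orP; [left|right];
  by apply/shadowP; exists x.
Qed.

Lemma shadow_layer r F : F \subset layer r.+1 -> shadow F \subset layer r.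
Proof.
move/subsetP=> FL; apply/subsetP => Y /shadowP[x xY /FL].
by rewrite !inE cardsU1 xY.
Qed.

Lemma shadow_layer0 F : F \subset layer 0 -> shadow F = set0.
Proof.
move/subsetP=> FL; apply/setP => Y; rewrite in_set0; apply/negbTE/shadowP => -[x xY /FL].
by rewrite inE cardsU1 xY.
Qed.

Lemma shadow_full r : r < #|T| -> shadow (layer r.+1) = layer r.
Proof.
move=> rT; apply/eqP; rewrite eqEsubset shadow_layer //=; apply/subsetP => Y.
rewrite inE => /eqP Yr; have : 0 < #|~: Y| by have := cardsC Y; lia.
case/card_gt0P => x; rewrite inE => xY; apply/shadowP; exists x => //.
by rewrite inE cardsU1 xY Yr.
Qed.

Lemma shadow_submod F G :
  #|shadow (F :|: G)| + #|shadow (F :&: G)| <= #|shadow F| + #|shadow G|.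
Proof.
rewrite -(cardsUI (shadow F)) shadowU leq_add2l subset_leq_card //.
by rewrite subsetI !shadowS ?subsetIl ?subsetIr.
Qed.

Lemma card_layer r : #|layer r| = 'C(#|T|, r).
Proof. exact: card_draws. Qed.

Lemma coK : involutive co.
Proof. by move=> F; apply/setP => X; rewrite !inE setCK. Qed.

Lemma card_co F : #|co F| = #|F|.
Proof.
rewrite -[RHS](card_imset _ (@setC_inj T)); apply: eq_card => X.
rewrite inE; apply/idP/imsetP => [h|[Y YF ->]]; last by rewrite setCK.
by exists (~: X); rewrite ?setCK.
Qed.

Lemma co_layer r s F : r + s = #|T| -> F \subset layer r -> co F \subset layer s.
Proof.
move=> rs /subsetP FL; apply/subsetP => X; rewrite inE => /FL; rewrite !inE.
by have := cardsC X; lia.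
Qed.

Lemma card_split e F : #|F| = #|del e F| + #|link e F|.
Proof.
rewrite -(cardsID [set X : {set T} | e \notin X] F); congr (_ + _).
  by apply: eq_card => X; rewrite !inE.
rewrite -(card_in_imset (f := fun X : {set T} => X :\ e) (D := pred_of_set _)); last first.
  move=> X Y; rewrite !inE !negbK => /andP[eX _] /andP[eY _] h.
  by rewrite -(setD1K eX) h setD1K.
apply: eq_card => X; rewrite inE; apply/imsetP/idP => [[Y]|/andP[eX XF]].
  by rewrite !inE negbK => /andP[eY YF] ->; rewrite setD11 setD1K.
by exists (e |: X); rewrite ?setU1K // !inE eqxx.
Qed.

(** A shadow member avoiding [e] arises by deleting either [e] or another point, hence from
    [link e F] or from [del e F]. Those containing [e] correspond to the shadow of the link. *)
Lemma card_shadow_split e F :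
  #|shadow F| = #|shadow (del e F) :|: link e F| + #|shadow (link e F)|.
Proof.
rewrite (card_split e (shadow F)); congr addn.
  apply: eq_card => Y; rewrite [LHS]inE in_setU; apply/andP/orP.
    case=> /shadowP[x xY YF] eY; case: (eqVneq x e) => [xe|xe].
      by right; rewrite inE eY -xe.
    by left; apply/shadowP; exists x => //; rewrite !inE YF negb_or eY eq_sym xe.
  case=> [/shadowP[x xY]|].
    by rewrite !inE negb_or => /andP[YF /andP[_ ->]]; split=> //; apply/existsP; exists x; rewrite xY.
  by rewrite inE => /andP[eY YF]; split=> //; apply/shadowP; exists e.
apply: eq_card => Y; rewrite [LHS]inE; apply/andP/shadowP.
  case=> eY /shadowP[x]; rewrite !inE negb_or => /andP[xe xY] h.
  by exists x => //; rewrite inE !inE negb_or eq_sym xe eY setUCA.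
case=> x xY; rewrite !inE negb_or => /andP[/andP[ex eY] h]; split=> //.
by apply/existsP; exists x; rewrite !inE negb_or eq_sym ex xY setUCA.
Qed.

Lemma link_layer e r F : F \subset layer r.+1 -> link e F \subset layer r.
Proof.
move/subsetP=> FL; apply/subsetP => X; rewrite !inE => /andP[eX /FL].
by rewrite inE cardsU1 eX.
Qed.

Lemma del_sub e F : del e F \subset F.
Proof. by apply/subsetP => X; rewrite inE => /andP[]. Qed.

(** Double counting: deleting [x] embeds the members containing [x] into the shadow members avoiding
    [x]. Summed over [x], each member counts its [r.+1] points and each shadow set the [#|T| - r]
    points outside it. *)
Lemma local_LYM r F : F \subset layer r.+1 ->
  #|F| * r.+1 <= #|shadow F| * (#|T| - r).
Proof.
move=> FL.
have -> : #|F| * r.+1 = \sum_(x : T) #|link x F|.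
  have h (X : {set T}) : X \in F -> r.+1 = \sum_(x : T) (x \in X).
    move/(subsetP FL); rewrite inE => /eqP <-.
    by rewrite -sum1_card big_mkcond; apply: eq_bigr => x _; case: (x \in X).
  rewrite -sum_nat_const (eq_bigr _ h) exchange_big; apply: eq_bigr => x _.
  have -> : #|link x F| = #|F| - #|del x F| by rewrite (card_split x F) addKn.
  have -> : #|F| = #|F :&: del x F| + #|F :\: del x F| by rewrite cardsID.
  have /setIidPr -> := del_sub x F; rewrite addKn -sum1_card.
  rewrite [RHS](eq_bigl (fun X => (X \in F) && (x \in X))); last first.
    by move=> X; rewrite !inE negb_and negbK; case: (X \in F); rewrite /= ?andbF ?orbF ?andbT.
  by rewrite [RHS]big_mkcondr; apply: eq_bigr => X _; case: (x \in X).
have -> : #|shadow F| * (#|T| - r) = \sum_(x : T) #|[set Y : {set T} in shadow F | x \notin Y]|.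
  have h (Y : {set T}) : Y \in shadow F -> #|T| - r = \sum_(x : T) (x \notin Y).
    move/(subsetP (shadow_layer FL)); rewrite inE => /eqP <-.
    rewrite -(cardsC Y) addKn -sum1_card big_mkcond; apply: eq_bigr => x _.
    by rewrite inE; case: (x \in Y).
  rewrite -sum_nat_const (eq_bigr _ h) exchange_big; apply: eq_bigr => x _.
  rewrite -sum1_card [RHS](eq_bigl (fun Y => (Y \in shadow F) && (x \notin Y))); last first.
    by move=> Y; rewrite inE.
  by rewrite big_mkcondr; apply: eq_bigr => Y _; case: (x \notin Y).
apply: leq_sum => x _; apply/subset_leq_card/subsetP => Y.
by rewrite !inE => /andP[xY YF]; rewrite xY andbT; apply/existsP; exists x; rewrite xY.
Qed.

(** The bound on [#|T|] says that [#|T| - r] is at most [r.+1], so the factors in [local_LYM]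
    compare the right way. *)
Lemma leq_card_shadow r F : F \subset layer r.+1 -> #|T| <= r.*2.+1 ->
  #|F| <= #|shadow F|.
Proof. by move=> /local_LYM h Tr; nia. Qed.

End Shadow.

(** * Uncrossing *)

Section Uncrossing.
Variable T : finType.
Implicit Types (X Y : {set T}) (F G Q : {set {set T}}) (s : {perm T}).

(** A transposition swapping a point of [X :\: Y] with one of [Y :\: X] shrinks the difference; such
    transpositions are composed. *)
Lemma exists_perm_imset X Y : #|X| = #|Y| -> exists s : {perm T}, s @: X = Y.
Proof.
move: {2}(#|X :\: Y|) (leqnn #|X :\: Y|) => d.
elim: d X => [|d IH] X Xd XY.
  exists 1%g; rewrite (eq_imset _ (@perm1 T)) imset_id; apply/eqP.
  by rewrite eqEcard XY leqnn andbT -setD_eq0 -cards_eq0 -leqn0.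
have [/eqP|XnY] := eqVneq X Y.
  move/eqP=> <-; exists 1%g; by rewrite (eq_imset _ (@perm1 T)) imset_id.
have DXY := cardsID Y X; have DYX := cardsID X Y; rewrite setIC in DYX.
have XD0 : 0 < #|X :\: Y|.
  rewrite card_gt0 setD_eq0; apply: contraNN XnY => h.
  by rewrite eqEcard h XY leqnn.
have YD0 : 0 < #|Y :\: X| by lia.
have [a] := card_gt0P XD0; have [b] := card_gt0P YD0.
rewrite !inE => /andP[bX bY] /andP[aY aX].
have tX : tperm a b @: X = b |: (X :\ a).
  rewrite -{1}(setD1K aX) imsetU1 tpermL; congr (_ |: _).
  rewrite -[RHS]imset_id; apply: eq_in_imset => x; rewrite !inE => /andP[xa xX].
  by rewrite tpermD // eq_sym // (memPn bX).
have [||s sE] := IH (tperm a b @: X).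
- suff : #|(b |: X :\ a) :\: Y| < #|X :\: Y| by rewrite tX; lia.
  apply: proper_card; apply/properP; split; last first.
    exists a; first by rewrite inE aY.
    by rewrite !inE aY eqxx /= orbF; apply: contraNneq bX => <-.
  apply/subsetP => x; rewrite !inE => /andP[xY /orP[/eqP xb|/andP[_ ->]]].
    by rewrite xb bY in xY.
  by rewrite xY.
- by rewrite card_imset //; apply: perm_inj.
exists (tperm a b * s)%g; rewrite -sE -imset_comp.
by apply: eq_imset => x; rewrite permM.
Qed.

Definition relabel s F : {set {set T}} := [set X : {set T} | s @: X \in F].

Lemma card_relabel s F : #|relabel s F| = #|F|.
Proof.
rewrite -(card_imset _ (imset_inj (@perm_inj _ s))); apply: eq_card => X.
apply/imsetP/idP => [[Y]|XF]; first by rewrite inE => h ->.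
exists (s^-1%g @: X); last by rewrite -imset_comp (eq_imset _ (permKV s)) imset_id.
by rewrite inE -imset_comp (eq_imset _ (permKV s)) imset_id.
Qed.

Lemma shadow_relabel s F : shadow (relabel s F) = relabel s (shadow F).
Proof.
apply/setP => Y; rewrite [RHS]inE; apply/shadowP/shadowP => -[x].
  rewrite inE imsetU1 => xY h; exists (s x) => //.
  by rewrite mem_imset //; apply: perm_inj.
rewrite -{1 2}(permKV s x) mem_imset; last exact: perm_inj.
by move=> xY h; exists (s^-1%g x); rewrite // inE imsetU1.
Qed.

Lemma relabel_layer s F r : F \subset layer T r -> relabel s F \subset layer T r.
Proof.
move/subsetP=> FL; apply/subsetP => X; rewrite inE => /FL.
by rewrite !inE card_imset //; apply: perm_inj.
Qed.

(* Passing to the union and the intersection does not increase the total size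
   of the shadows, and as long as the first family is not the whole layer, a
   relabelling of the second one makes the union grow. *)
Lemma uncross r F G : F \subset layer T r -> G \subset layer T r ->
  exists F' G' : {set {set T}},
    [/\ F' \subset layer T r, G' \subset layer T r, #|F'| + #|G'| = #|F| + #|G|,
        #|shadow F'| + #|shadow G'| <= #|shadow F| + #|shadow G|
      & F' = layer T r \/ G' = set0].
Proof.
move: {2}(#|layer T r :\: F|) (leqnn #|layer T r :\: F|) => d.
elim: d F G => [|d IH] F G Fd FL GL.
  exists F, G; split=> //; left; apply/eqP; rewrite eqEsubset FL -setD_eq0.
  by rewrite -cards_eq0 -leqn0.
have [->|[X XG]] := set_0Vmem G; first by exists F, set0; split=> //; [exact: sub0set|right].
have [/eqP h|[Y]] := set_0Vmem (layer T r :\: F).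
  by exists F, G; split=> //; left; apply/eqP; rewrite eqEsubset FL -setD_eq0 h.
rewrite inE => /andP[YF YL].
(* Pulling [G] back along [s] puts the missing set [Y] into it, so the union with [F] gains [Y]. *)
have [s sE] : exists s : {perm T}, s @: Y = X.
  apply: exists_perm_imset; move: YL (subsetP GL X XG); rewrite !inE.
  by move=> /eqP -> /eqP ->.
set H := relabel s G.
have HL : H \subset layer T r by exact: relabel_layer.
have YH : Y \in H by rewrite inE sE.
have [|||F' [G' [F'L G'L cE sle e]]] := IH (F :|: H) (F :&: H).
- suff : #|layer T r :\: (F :|: H)| < #|layer T r :\: F| by lia.
  apply: proper_card; apply/properP; split; first by rewrite setDS ?subsetUl.
  by exists Y; rewrite in_setD ?YF ?YL // in_setU YH orbT.
- by rewrite subUset FL.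
- by apply: subset_trans FL; apply: subsetIl.
exists F', G'; split=> //; first by rewrite cE cardsUI card_relabel.
apply: leq_trans sle _; apply: leq_trans (shadow_submod F H) _.
by rewrite shadow_relabel card_relabel.
Qed.

End Uncrossing.

(** * Initial segments of the squashed order *)

Section InitialSegments.
Variable n : nat.
Implicit Types (X Y : {set 'I_n}) (F G I : {set {set 'I_n}}).

(* Comparing in squashed order amounts to comparing binary numbers. *)
Definition weight X : nat := \sum_(x in X) 2 ^ x.

Lemma weight_below a X : (forall x, x \in X -> x < a) -> weight X < 2 ^ a.
Proof.
elim: a X => [|a IH] X Xa.
  have -> : X = set0 by apply/setP => x; rewrite inE; apply/negP => /Xa.
  by rewrite /weight big_set0.
case: (ltnP a n) => an; last first.
  (* Here [n <= a], so every point already lies below [a]. *)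
  rewrite expnS; have : weight X < 2 ^ a by apply: IH => x _; apply: leq_trans an.
  by lia.
pose e := Ordinal an.
have h : weight (X :\ e) < 2 ^ a.
  apply: IH => x; rewrite !inE => /andP[xe /Xa]; rewrite ltnS leq_eqVlt => /orP[/eqP h|//].
  by case/eqP: xe; apply: val_inj.
suff : weight X <= 2 ^ a + weight (X :\ e) by rewrite expnS; lia.
case: (boolP (e \in X)) => eX; first by rewrite /weight (big_setD1 e eX).
suff -> : X :\ e = X by apply: leq_addl.
by apply/setDidPl; rewrite disjoint_sym disjoints1.
Qed.

Lemma weight_ge x X : x \in X -> 2 ^ x <= weight X.
Proof. by move=> xX; rewrite /weight (big_setD1 x xX) leq_addr. Qed.

Lemma weightU1 x X : x \notin X -> weight (x |: X) = 2 ^ x + weight X.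
Proof. by move=> xX; rewrite /weight big_setU1. Qed.

Lemma weight_split X Y : weight X = weight (X :&: Y) + weight (X :\: Y).
Proof. by rewrite /weight (big_setID Y). Qed.

(** The common part cancels, and the largest point [z] of the difference outweighs all of
    [X :\: Y]. *)
Lemma squashed_lt_weight X Y : squashed_lt X Y -> weight X < weight Y.
Proof.
case/existsP => z /and3P[zd zY /forall_inP zmax].
rewrite (weight_split X Y) (weight_split Y X) setIC ltn_add2l.
apply: (@leq_trans (2 ^ z)); last first.
  by apply: weight_ge; move: zd; rewrite in_setU !in_setD zY.
apply: weight_below => x xXY.
have xd : x \in symdiff X Y by rewrite /symdiff inE xXY.
rewrite ltn_neqAle zmax // andbT; apply: contraTneq zY => /val_inj <-.
by move: xXY; rewrite inE => /andP[].
Qed.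

Lemma squashed_total X Y : X != Y -> squashed_lt X Y || squashed_lt Y X.
Proof.
move=> XY; have [z0 z0d] : exists z, z \in symdiff X Y.
  apply/set0Pn; apply: contraNneq XY => /eqP; rewrite setU_eq0 !setD_eq0.
  by rewrite eqEsubset.
have [z zd zmax] := arg_maxnP (fun x : 'I_n => x : nat) z0d; rewrite -/(z \in symdiff X Y) in zd.
case: (boolP (z \in Y)) => zY; apply/orP; [left|right]; apply/existsP; exists z; apply/and3P.
  by split=> //; apply/forall_inP => y /zmax.
have sym : symdiff Y X = symdiff X Y by rewrite /symdiff setUC.
split; [by rewrite sym|by move: zd; rewrite in_setU !in_setD (negbTE zY) andbF orbF|].
by apply/forall_inP => y; rewrite sym => /zmax.
Qed.

Lemma squashed_ltE X Y : squashed_lt X Y = (weight X < weight Y).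
Proof.
apply/idP/idP => [|h]; first exact: squashed_lt_weight.
have /squashed_total/orP[//|/squashed_lt_weight] : X != Y by apply: contraTneq h => ->; rewrite ltnn.
by lia.
Qed.

Lemma weight_inj : injective weight.
Proof.
move=> X Y e; apply/eqP; apply: contraTT isT => /squashed_total.
by rewrite !squashed_ltE e ltnn.
Qed.

Lemma weightC X : weight X + weight (~: X) = weight setT.
Proof. by rewrite [RHS](weight_split _ X) setTI setTD. Qed.

(** The weights of a set and its complement have a constant sum, so complementation reverses the
    order. *)
Lemma squashed_ltC X Y : squashed_lt (~: X) (~: Y) = squashed_lt Y X.
Proof. by rewrite !squashed_ltE; have := weightC X; have := weightC Y; lia. Qed.

Definition below a : {set 'I_n} := [set x : 'I_n | x < a].

(** The parameter [a] restricts the ground set to its first [a] points, which makes an induction on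
    the ground set possible. *)
Definition initial_segment (a r : nat) I :=
  (forall X, X \in I -> #|X| = r /\ X \subset below a) /\
  (forall X Y, X \in I -> #|Y| = r -> Y \subset below a -> weight Y < weight X -> Y \in I).

Lemma card_below a : a <= n -> #|below a| = a.
Proof.
move=> an; have w_inj : injective (widen_ord an) by move=> x y [] /val_inj.
rewrite -[RHS]card_ord -(card_imset _ w_inj).
apply: eq_card => x; rewrite inE; apply/idP/imsetP => [xa|[y _ ->]]; last exact: (ltn_ord y).
by exists (Ordinal xa) => //; apply: val_inj.
Qed.

Lemma belowS a (an : a < n) : below a.+1 = Ordinal an |: below a.
Proof. by apply/setP => x; rewrite !inE -val_eqE /= ltnS leq_eqVlt. Qed.

Lemma belowF a (an : a < n) : Ordinal an \notin below a.
Proof. by rewrite inE ltnn. Qed.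

Lemma weight_sub_below a X : X \subset below a -> weight X < 2 ^ a.
Proof. by move=> h; apply: weight_below => x /(subsetP h); rewrite inE. Qed.

(** Induction on the ground set. If some member contains the top point [e], the segment consists of
    all sets avoiding [e] together with an initial segment of links; splitting its shadow at [e]
    reproduces the recursion [kk_cascade]. *)
Lemma card_shadow_initial a r I : a <= n -> initial_segment a r I ->
  #|shadow I| = kk r #|I|.
Proof.
elim: a r I => [|a IH] r I an [Ib Id].
  case: r Ib {Id} => [|r] Ib.
    rewrite kk0n shadow_layer0 ?cards0 //; apply/subsetP => X /Ib[].
    by rewrite inE => ->.
  suff -> : I = set0 by rewrite shadow0 cards0 kkn0.
  apply/setP => X; rewrite in_set0; apply/negP => /Ib[Xr /subset_leq_card].
  by rewrite Xr card_below.
pose e := Ordinal an.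
have [/eqP L0|[Y1]] := set_0Vmem (link e I).
  have Ie X : X \in I -> e \notin X.
    move=> XI; apply/negP => eX; have := in_set0 (X :\ e); rewrite -(eqP L0).
    by rewrite inE setD11 setD1K // XI.
  apply: IH; first exact: ltnW.
  split=> [X XI|X Y XI Yr Ya]; last first.
    by apply: Id => //; apply: subset_trans Ya _; rewrite belowS subsetUr.
  have [Xr Xa] := Ib X XI; split=> //; apply/subsetP => x xX.
  have := subsetP Xa x xX; rewrite belowS in_setU1 => /orP[/eqP xe|//].
  by move: (Ie X XI); rewrite /e -xe xX.
rewrite inE => /andP[eY1 Y1I].
case: r Ib Id => [|r] Ib Id.
  by have [] := Ib _ Y1I; rewrite cardsU1 eY1.
(* A set inside [below a] weighs less than [2 ^ a], hence less than the member [e |: Y1], and so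
   belongs to [I]. *)
have delE : del e I = [set X : {set 'I_n} | (#|X| == r.+1) && (X \subset below a)].
  apply/setP => X; rewrite !inE; apply/andP/andP.
    case=> XI eX; have [Xr Xa] := Ib X XI; rewrite Xr; split=> //.
    apply/subsetP => x xX; have := subsetP Xa x xX; rewrite belowS in_setU1.
    by case/orP=> [/eqP xe|//]; move: eX; rewrite /e -xe xX.
  case=> /eqP Xr Xa; split; last by apply: contra (belowF an) => /(subsetP Xa).
  apply: Id Y1I Xr _ _; first by apply: subset_trans Xa _; rewrite belowS subsetUr.
  apply: leq_trans (weight_sub_below Xa) _.
  by have := @weight_ge e (e |: Y1) (setU11 _ _).
have linkI : initial_segment a r (link e I).
  split=> [X|X Y].
    rewrite inE => /andP[eX XI]; have [] := Ib _ XI; rewrite cardsU1 eX => -[Xr] Xa.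
    split=> //; apply/subsetP => x xX.
    have := subsetP Xa x; rewrite in_setU1 xX orbT belowS in_setU1 => /(_ isT).
    by case/orP=> [/eqP xe|//]; move: eX; rewrite /e -xe xX.
  rewrite !inE => /andP[eX XI] Yr Ya YX.
  have eY : e \notin Y by apply: contra (belowF an) => /(subsetP Ya).
  rewrite eY /=; apply: Id XI _ _ _.
  - by rewrite cardsU1 eY Yr.
  - by rewrite belowS setUS.
  - by rewrite !weightU1 // ltn_add2l.
have cdel : #|del e I| = 'C(a, r.+1).
  rewrite delE -[X in 'C(X, _)](card_below (ltnW an)) -cards_draws.
  by apply: eq_card => X; rewrite !inE andbC.
have clink : #|link e I| <= 'C(a, r).
  rewrite -[X in 'C(X, _)](card_below (ltnW an)) -cards_draws; apply/subset_leq_card/subsetP => X.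
  by case: linkI => h _ /h[Xr Xa]; rewrite inE Xr Xa eqxx.
have link0 : 0 < #|link e I| by apply/card_gt0P; exists Y1; rewrite inE eY1.
rewrite (card_shadow_split e) (card_split e I) cdel kk_cascade //; last by lia.
congr (_ + _); last by apply: IH => //; exact: ltnW.
rewrite -[X in 'C(X, _)](card_below (ltnW an)) -cards_draws; apply: eq_card => Y.
rewrite !inE; apply/orP/andP.
  case=> [/existsP[x]|/andP[eY YI]].
    rewrite delE inE cardsU1 => /andP[->] /andP[h1 h2]; split; last by [].
    by apply: subset_trans h2; apply: subsetUr.
  case: linkI => h _; have [|-> ->] := h Y; by rewrite ?inE ?eY.
case=> Ya /eqP Yr.
(* Either [Y] extends by a point below [a] to a member of [del e I], or [Y] is all of [below a] and
   coincides with [Y1] by cardinality. *)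
have [/eqP h|[x]] := set_0Vmem (below a :\: Y); last first.
  rewrite inE => /andP[xY xa]; left; apply/existsP; exists x; rewrite xY delE inE.
  by rewrite cardsU1 xY Yr eqxx subUset Ya sub1set xa.
right; have -> : Y = Y1; last by rewrite eY1.
rewrite setD_eq0 in h; have YE : Y = below a by apply/eqP; rewrite eqEsubset Ya.
have [Y1r Y1a] : #|Y1| = r /\ Y1 \subset below a by case: linkI => k _; apply: k; rewrite inE eY1.
apply/eqP; rewrite eq_sym eqEcard Yr -Y1r leqnn andbT -YE in Y1a *; exact: Y1a.
Qed.

(** Induction on [m]: the lightest element of [S] not yet taken has rank exactly [m]. *)
Lemma card_rank_lt (U : finType) (w : U -> nat) (S : {set U}) m :
  injective w -> m <= #|S| ->
  #|[set x in S | #|[set y in S | w y < w x]| < m]| = m.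
Proof.
move=> w_inj; pose rk x := #|[set y in S | w y < w x]|.
have rk_le x y : w x <= w y -> rk x <= rk y.
  by move=> xy; apply/subset_leq_card/subsetP => z; rewrite !inE => /andP[-> /leq_trans->].
have rk_lt x y : x \in S -> w x < w y -> rk x < rk y.
  move=> xS xy; apply/proper_card/properP; split.
    by apply/subsetP => z; rewrite !inE => /andP[-> /ltn_trans->].
  by exists x; rewrite !inE ?xS ?ltnn.
elim: m => [|m IH] mS.
  by apply: eq_card0 => x; rewrite !inE ltn0 andbF.
pose G := [set x in S | rk x < m].
have GE : #|G| = m by apply: IH; exact: ltnW.
have [x0] : exists x, x \in S :\: G.
  apply/set0Pn; rewrite -card_gt0; have := cardsID G S.
  have /setIidPr -> : G \subset S by apply/subsetP => x; rewrite inE => /andP[].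
  by lia.
move=> x0D; have [x xD xmin] := arg_minnP w x0D.
have /andP[xS xG] : (x \in S) && (x \notin G) by rewrite andbC -in_setD.
have rkx : rk x = m.
  rewrite -GE; apply: eq_card => y; rewrite !inE; apply: andb_id2l => yS.
  apply/idP/idP => [yx|ym]; last first.
    rewrite ltnNge; apply: contra xG => /rk_le h; rewrite inE xS /=; exact: leq_ltn_trans h ym.
  rewrite ltnNge; apply/negP => h; have : y \in S :\: G by rewrite in_setD yS inE yS -leqNgt h.
  by move/xmin; rewrite leqNgt yx.
transitivity (1 + #|G|); last by rewrite GE.
have -> : 1 = (x \notin G) by rewrite xG.
rewrite -cardsU1; apply: eq_card => y; rewrite in_setU1 !inE -/(rk y) ltnS leq_eqVlt.
have [->|yx] := eqVneq y x; first by rewrite xS rkx eqxx.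
apply: andb_id2l => yS /=; rewrite -rkx.
have : w y != w x by apply: contraNneq yx => /w_inj ->.
rewrite neq_ltn => /orP[/(rk_lt _ _ yS)|/(rk_lt _ _ xS)]; by case: ltngtP.
Qed.

(** The family $F_{n,r}(m)$, with squashed order expressed by weights. *)
Definition first_sets r m : {set {set 'I_n}} :=
  [set X in layer 'I_n r | #|[set Y in layer 'I_n r | weight Y < weight X]| < m].

Lemma first_sets_layer r m : first_sets r m \subset layer 'I_n r.
Proof. by apply/subsetP => X; rewrite inE => /andP[]. Qed.

Lemma card_first_sets r m : m <= 'C(n, r) -> #|first_sets r m| = m.
Proof. by move=> h; apply: card_rank_lt; [exact: weight_inj|rewrite card_layer card_ord]. Qed.

Lemma card_shadow_first_sets r m : m <= 'C(n, r) -> #|shadow (first_sets r m)| = kk r m.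
Proof.
move=> h; rewrite (@card_shadow_initial n r) ?card_first_sets //.
have bn : below n = setT by apply/setP => x; rewrite !inE ltn_ord.
split=> [X|X Y].
  by rewrite !inE => /andP[/eqP -> _]; rewrite bn subsetT.
rewrite !inE => /andP[_ Xm] Yr _ YX; rewrite Yr eqxx /=.
apply: leq_ltn_trans Xm; apply/subset_leq_card/subsetP => Z.
by rewrite !inE => /andP[-> /ltn_trans->].
Qed.

End InitialSegments.

(** * The Kruskal-Katona theorem *)

Section KruskalKatona.

(** All ground types are included because the induction on [r] also uses the bound on ['I_n], where
    [kk_uncross] lives. *)
Definition kk_bound (r : nat) : Prop := forall (T : finType) (F : {set {set T}}),
  F \subset layer T r -> kk r #|F| <= #|shadow F|.

(** The first [x] and the first [y] sets have shadows of sizes [kk r x] and [kk r y]. Uncrossing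
    them leaves a full or an empty family, to which [kk_bound] applies. *)
Lemma kk_uncross r n x y : kk_bound r -> x <= 'C(n, r) -> y <= 'C(n, r) ->
  (x + y <= 'C(n, r) -> kk r (x + y) <= kk r x + kk r y) /\
  ('C(n, r) <= x + y ->
     kk r 'C(n, r) + kk r (x + y - 'C(n, r)) <= kk r x + kk r y).
Proof.
move=> KK xn yn.
have [F [G [FL GL cE sle FG]]] :=
  uncross (first_sets_layer n r x) (first_sets_layer n r y).
rewrite !card_shadow_first_sets // in sle; rewrite !card_first_sets // in cE.
have kF := leq_trans (leq_add (KK _ F FL) (KK _ G GL)) sle.
have Fn : #|F| <= 'C(n, r).
  by have := subset_leq_card FL; rewrite card_layer card_ord.
have [[e|e] xy_le] := (FG, leqP (x + y) 'C(n, r)).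
  have cF : #|F| = 'C(n, r) by rewrite e card_layer card_ord.
  rewrite cF in cE kF; split=> h; last by rewrite -cE addKn.
  have G0 : #|G| = 0 by lia.
  by move: kF; rewrite G0 kkn0 -cE G0 !addn0.
have cG : #|G| = 0 by rewrite e cards0.
rewrite cG addn0 in cE; rewrite cG kkn0 addn0 cE in kF; split=> // h.
by have -> : x + y - 'C(n, r) = 0; [lia | rewrite kkn0 addn0 (leq_trans _ kF) // kk_mono].
Qed.

(** The Eckhoff-Wegner inequality; [m0] and [m1] stand for the numbers of members avoiding and
    containing a fixed point. *)
Definition kk_split_bound (r : nat) : Prop := forall m0 m1 : nat,
  kk r.+1 (m0 + m1) <= maxn (kk r.+1 m0) m1 + kk r m1.

Lemma kk_split_bound1 : kk_split_bound 0.
Proof.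
have kk1 m : kk 1 m = (0 < m).
  case: m => [|m]; first exact: kkn0.
  have -> : m.+1 = 'C(m, 1) + 1 by rewrite bin1 addn1.
  by rewrite kk_cascade ?bin0 ?kk0n // bin1 addn1.
move=> m0 m1; rewrite kk0n !kk1; lia.
Qed.

Lemma kk_split_boundS r :
  kk_bound r.+1 -> kk_split_bound r -> kk_split_bound r.+1.
Proof.
move=> KK IH m0 m1.
case: (posnP m1) => [->|m1_gt0]; first by rewrite addn0 maxn0 leq_addr.
(* The cases follow the maximum; the leading binomial is split off [m1] in the first case and off
   [m0] in the second. *)
case: (ltnP (kk r.+2 m0) m1) => [m0m1|m1m0].
  have [b [z [rb m1E zb]]] := bin_decomp r m1_gt0.
  have b0 : 0 < 'C(b.+1, r.+2) by rewrite bin_gt0.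
  have k1 : kk r.+1 m1 = 'C(b, r) + kk r z by rewrite m1E kk_cascade //; lia.
  have bS1 := binS b r.+1; have bS := binS b r.
  (* Removing ['C(b.+1, r.+2)] from the sum reduces the claim to a remainder one level down. *)
  have goal_from y : y <= 'C(b, r.+1) + z -> m0 + m1 = 'C(b.+1, r.+2) + y ->
      kk r.+1 y <= z + kk r z ->
      kk r.+2 (m0 + m1) <= m1 + kk r.+1 m1.
    by move=> yle -> yk; rewrite kk_cascade //; lia.
  have [m0b|m0b] := leqP m0 'C(b, r.+2).
    have h1 : m0 + m1 <= 'C(b.+1, r.+2) + z by lia.
    apply: leq_trans (kk_mono r.+2 h1) _; rewrite kk_cascade //; try lia.
    by have := IH 0 z; rewrite kkn0 add0n max0n; lia.
  have [xb|xb] := leqP (m0 - 'C(b, r.+2)) 'C(b, r.+1); last first.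
    (* Impossible: [kk r.+2 m0] would be at least ['C(b.+1, r.+1)], which exceeds [m1]. *)
    have : kk r.+2 'C(b.+1, r.+2) <= kk r.+2 m0 by apply: kk_mono; lia.
    by rewrite kk_bin; lia.
  set x := m0 - _ in xb.
  have m0E : m0 = 'C(b, r.+2) + x by rewrite subnKC // ltnW.
  have k0 : kk r.+2 m0 = 'C(b, r.+1) + kk r.+1 x.
    by rewrite m0E kk_cascade //; lia.
  (* The case hypothesis says [kk r.+1 x < z], so the maximum in the induction hypothesis is [z]. *)
  apply: (goal_from (x + z)); [lia|lia|].
  by have := IH x z; lia.
have m0_gt0 : 0 < m0 by case: (m0) m1m0 => //; rewrite kkn0; lia.
have [a [x [ra m0E xa]]] := bin_decomp r.+1 m0_gt0.
have a0 : 0 < 'C(a.+1, r.+2) by rewrite bin_gt0; lia.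
have a0' : 0 < 'C(a, r.+2) by rewrite bin_gt0.
have k0 : kk r.+2 m0 = 'C(a, r.+1) + kk r.+1 x.
  by rewrite m0E kk_cascade //; lia.
have bS1 := binS a r.+1; have bS := binS a r.
have kT : kk r.+1 'C(a, r.+1) = 'C(a, r) by rewrite kk_bin //; lia.
have [m1a|m1a] := leqP m1 'C(a, r.+1).
  (* Both [x] and [m1] fit into a layer of size ['C(a, r.+1)]; which inequality is needed depends on
     whether their sum does. *)
  have [sub super] := kk_uncross KK (ltnW xa) m1a.
  have [h|h] := leqP (x + m1) 'C(a, r.+1).
    have -> : m0 + m1 = 'C(a, r.+2) + (x + m1) by lia.
    by rewrite kk_cascade //; have := sub h; lia.
  have -> : m0 + m1 = 'C(a.+1, r.+2) + (x + m1 - 'C(a, r.+1)) by lia.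
  by rewrite kk_cascade; [have := super (ltnW h); lia|lia|lia].
pose z := m1 - 'C(a, r.+1).
have m1E : m1 = 'C(a, r.+1) + z by rewrite subnKC // ltnW.
have kx : kk r.+1 x <= 'C(a, r) by rewrite -kT kk_mono // ltnW.
have k1 : kk r.+1 m1 = 'C(a, r) + kk r z by rewrite m1E kk_cascade //; lia.
have -> : m0 + m1 = 'C(a.+1, r.+2) + (x + z) by lia.
rewrite kk_cascade; [|lia|lia].
(* Here [m1 <= kk r.+2 m0] says [z <= kk r.+1 x], so the maximum is [kk r.+1 x]. *)
by have := IH x z; lia.
Qed.

(** Inner induction on [#|F|], splitting at a point [e] of some member so that [del e F] is smaller.
    The part of the shadow avoiding [e] contains both [shadow (del e F)] and [link e F], whence the
    maximum. *)
Lemma kk_boundS r : kk_bound r -> kk_split_bound r -> kk_bound r.+1.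
Proof.
move=> KKr W T F; move: {2}#|F| (leqnn #|F|) => d.
elim: d F => [|d IH] F Fd FL.
  by move: Fd; rewrite leqn0 => /eqP ->; rewrite kkn0.
have [->|[X XF]] := set_0Vmem F; first by rewrite cards0 kkn0.
have /card_gt0P[e eX] : 0 < #|X| by move: (subsetP FL X XF); rewrite inE => /eqP ->.
have e_link : X :\ e \in link e F by rewrite inE setD11 setD1K.
have linkF : 0 < #|link e F| by apply/card_gt0P; exists (X :\ e).
have cF := card_split e F; rewrite cF (card_shadow_split e).
apply: leq_trans (W _ _) _; apply: leq_add; last by apply: KKr; exact: link_layer.
rewrite geq_max (leq_trans _ (subset_leq_card (subsetUl _ _))) ?subset_leq_card ?subsetUr //.
by apply: IH; [lia | apply: subset_trans FL; exact: del_sub].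
Qed.

Theorem kruskal_katona r : kk_bound r.
Proof.
suff [] : kk_bound r /\ kk_split_bound r by [].
elim: r => [|r [KK W]]; first by split; [move=> T F _; rewrite kk0n | exact: kk_split_bound1].
by have KKS := kk_boundS KK W; split=> //; exact: kk_split_boundS.
Qed.

End KruskalKatona.

(** * Two antichains *)

Section TwoAntichains.
Variable T : finType.
Implicit Types (X Y : {set T}) (A C D F P U W Z : {set {set T}}).

Definition downs A t : {set {set T}} :=
  [set X : {set T} | (#|X| == t) && [exists Y in A, X \subset Y]].

Lemma antichain_co A : antichain A -> antichain (co A).
Proof.
move=> Aa X Y; rewrite !inE => XA YA XY; apply: (@setC_inj T).
by apply/esym/Aa; rewrite // setCS.
Qed.

(** Members are pushed down from the top one level at a time. Shadows do not shrink at these levels,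
    and the antichain property keeps members of size [t] apart from the shadow of what came from
    above. *)
Lemma leq_card_downs A t : antichain A -> #|T| <= t.*2.+1 ->
  #|[set X in A | t <= #|X|]| <= #|downs A t|.
Proof.
move=> Aa; move: {2}(#|T| - t) (leqnn (#|T| - t)) => d.
elim: d t => [|d IH] t td Tt.
  apply/subset_leq_card/subsetP => X; rewrite !inE => /andP[XA Xt].
  apply/andP; split; last by apply/exists_inP; exists X.
  by have := subset_leq_card (subsetT X); rewrite cardsT; lia.
have [tT|tT] := leqP #|T| t; first by apply: IH; lia.
have IHt : #|[set X in A | t < #|X|]| <= #|downs A t.+1| by apply: IH; lia.
have dL : downs A t.+1 \subset layer T t.+1.
  by apply/subsetP => X; rewrite !inE => /andP[].
have sh := leq_card_shadow dL Tt.
pose At := [set X in A | #|X| == t].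
have At_sh : #|At :|: shadow (downs A t.+1)| = #|At| + #|shadow (downs A t.+1)|.
  rewrite cardsU; have /eqP -> : At :&: shadow (downs A t.+1) == set0; last by rewrite cards0 subn0.
  rewrite setI_eq0; apply/pred0Pn => -[X /= /andP[]].
  rewrite inE => /andP[XA _] /shadowP[x xX]; rewrite inE => /andP[_ /exists_inP[Y YA]].
  rewrite subUset sub1set => /andP[xY XY]; move: xY; rewrite -(Aa _ _ XA YA XY).
  by rewrite (negbTE xX).
have le1 : #|At :|: shadow (downs A t.+1)| <= #|downs A t|.
  apply/subset_leq_card; rewrite subUset; apply/andP; split; apply/subsetP => X.
    rewrite !inE => /andP[XA ->]; by apply/exists_inP; exists X.
  move=> Xs; have := subsetP (shadow_layer dL) X Xs; rewrite !inE => ->.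
  case/shadowP: Xs => x _; rewrite inE => /andP[_ /exists_inP[Y YA]].
  by rewrite subUset => /andP[_ XY]; apply/exists_inP; exists Y.
have le2 : #|[set X in A | t <= #|X|]| <= #|At| + #|[set X in A | t < #|X|]|.
  rewrite -(cardsID [set X : {set T} | #|X| == t]) leq_add //.
    by apply/subset_leq_card/subsetP => X; rewrite !inE => /andP[/andP[-> _] ->].
  apply/subset_leq_card/subsetP => X; rewrite !inE => /andP[h1 /andP[-> h2]].
  by rewrite ltn_neqAle eq_sym h1.
lia.
Qed.

(** [co (shadow (co P))] is the shade of [P]; a member of [U] in it would have a member of [P] in
    its shadow. *)
Lemma disjoint_shadow_co P U :
  [disjoint P & shadow U] -> [disjoint U & co (shadow (co P))].
Proof.
move=> PU; apply/pred0Pn => -[Y /= /andP[YU]]; rewrite inE => /shadowP[x].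
rewrite !inE negbK setCU setCK => xY YxP; have /pred0P/(_ (Y :\ x)) /= := PU.
rewrite setDE setIC YxP /= => /shadowP[]; exists x; first by rewrite !inE eqxx.
by rewrite setIC -setDE setD1K.
Qed.

Lemma leq_card_disjoint_shadow r s P U : r + s.+1 = #|T| ->
  U \subset layer T r.+1 -> P \subset layer T r -> [disjoint P & shadow U] ->
  #|U| + #|shadow (co P)| <= #|layer T r.+1|.
Proof.
move=> rs UL PL /disjoint_shadow_co UP.
have UP0 : U :&: co (shadow (co P)) = set0 by apply/eqP; rewrite setI_eq0.
have := cardsUI U (co (shadow (co P))); rewrite UP0 cards0 addn0 card_co => <-.
apply: subset_leq_card; rewrite subUset UL (@co_layer _ s) //; first by lia.
by apply: shadow_layer; apply: (@co_layer _ r).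
Qed.

Lemma exists_subset_card F m : m <= #|F| -> exists2 G : {set {set T}}, G \subset F & #|G| = m.
Proof.
elim: m => [|m IH] mF; first by exists set0; rewrite ?sub0set ?cards0.
have [|G GF Gm] := IH; first exact: ltnW.
have [x] : exists x, x \in F :\: G.
  by apply/set0Pn; rewrite -card_gt0; have := cardsID G F; have /setIidPr -> := GF; lia.
rewrite inE => /andP[xG xF]; exists (x |: G); last by rewrite cardsU1 xG Gm.
by rewrite subUset sub1set xF.
Qed.

Variable h : nat.
Hypothesis cardT : #|T| = h.+1.*2.
(** Half of the ground set is [h.+1], so [M] is the middle layer and every level is one higher in
    terms of [h] than in the overview. *)
Let M := layer T h.+1.

Let cardM : #|layer T h.+2| = #|layer T h|.
Proof. by rewrite !card_layer -bin_sub cardT; [congr 'C(_, _); lia|lia]. Qed.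

(** The full layer maximizes size minus shadow size: the shade of the [h]-sets missed by the shadow
    is at least as large as their number and is disjoint from [F]. *)
Lemma excess_le_layer F : F \subset M -> #|F| + #|layer T h| <= #|M| + #|shadow F|.
Proof.
move=> FM; pose D := layer T h :\: shadow F.
have DL : D \subset layer T h by apply: subsetDl.
have cD : co D \subset layer T h.+2 by apply: co_layer DL; lia.
have cDs : #|co D| <= #|shadow (co D)| by apply: leq_card_shadow cD _; lia.
have DF : [disjoint D & shadow F] by rewrite -setI_eq0 setIDAC setDIl setDv setI0.
have := @leq_card_disjoint_shadow h h.+1 _ _ _ FM DL DF; rewrite card_co in cDs.
have := cardsID (shadow F) (layer T h); have /setIidPr -> := shadow_layer FM.
rewrite -/D -/M; lia.
Qed.

(** [V] holds the complements of the small sets of the overview, so that [U] and [V] play symmetric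
    roles. *)
Lemma four_families (U V Z W : {set {set T}}) :
  U \subset layer T h.+2 -> V \subset layer T h.+2 -> Z \subset M -> W \subset M ->
  [disjoint Z & shadow U] -> [disjoint co W & shadow V] ->
  exists R : {set {set T}}, [/\ R \subset M, #|R| <= #|Z :&: W| &
    #|U| + #|V| + #|Z| + #|W| + #|shadow R| <= #|M| + #|layer T h.+2| + #|R|].
Proof.
move=> UL VL ZM WM ZU WV.
(* The witness for [p] will be [#|Q1 :&: Q2|], the loss in bounding [#|Z :|: W|] by [#|Q1 :|: Q2|].
   If [R] is larger than [Z :&: W], a subfamily of that size works. *)
suff [R [p [RM Rp Zp le]]] : exists (R : {set {set T}}) p,
    [/\ R \subset M, #|R| <= p, #|Z :&: W| <= p &
     #|U| + #|V| + #|Z| + #|W| + #|shadow R| + p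
       <= #|M| + #|layer T h.+2| + #|Z :&: W| + #|R|].
  have [RZ|ZR] := leqP #|R| #|Z :&: W|; first by exists R; split=> //; move: le Rp Zp; clear; lia.
  have [G GR Gc] := exists_subset_card (ltnW ZR).
  exists G; split; [exact: subset_trans RM|by rewrite Gc|].
  by move: (subset_leq_card (shadowS GR)) Gc le Rp; clear; lia.
pose Q1 := M :\: shadow U; pose Q2 := co (M :\: shadow V).
have coM F : F \subset M -> co F \subset M by apply: co_layer; rewrite cardT; clear; lia.
have Q1M : Q1 \subset M by apply: subsetDl.
have Q2M : co Q2 \subset M by rewrite coK subsetDl.
have ZQ : Z \subset Q1 by rewrite subsetD ZM.
have WQ : W \subset Q2.
  have : co W \subset co Q2 by rewrite coK subsetD WV coM.
  by move/subsetP=> s; apply/subsetP => X XW; have := s (~: X); rewrite !inE !setCK; apply.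
have dis F : [disjoint M :\: shadow F & shadow F].
  by rewrite -setI_eq0 setIDAC setDIl setDv setI0.
have leU : #|U| + #|shadow (co Q1)| <= #|layer T h.+2|.
  by apply: (@leq_card_disjoint_shadow _ h) UL Q1M (dis U); rewrite cardT; clear; lia.
have leV : #|V| + #|shadow Q2| <= #|layer T h.+2|.
  rewrite -{1}(coK Q2); apply: (@leq_card_disjoint_shadow _ h) VL Q2M _; first by rewrite cardT; clear; lia.
  by rewrite coK.
have [R1 [R2 [R1M R2M cE sle R12]]] := uncross (coM _ Q1M) (coM _ Q2M).
rewrite coK ?(card_co Q1) in cE sle.
have ZW := cardsUI Z W; have QQ := cardsUI Q1 Q2.
have ZWQ : #|Z :|: W| <= #|Q1 :|: Q2| by apply: subset_leq_card; apply: setUSS.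
have ZWQI : #|Z :&: W| <= #|Q1 :&: Q2| by apply: subset_leq_card; apply: setISS.
have cM := cardM.
have QM : #|Q1 :|: Q2| <= #|M|.
  by rewrite subset_leq_card // subUset Q1M -(coK Q2) coM.
case: R12 => e.
  have cR1 : #|R1| = #|M| by rewrite e.
  have shR1 : #|shadow R1| = #|layer T h| by rewrite e shadow_full // cardT; clear; lia.
  (* With [R1] full, [#|R2|] is [#|Q1| + #|Q2| - #|M|], which is at most [#|Q1 :&: Q2|]. *)
  exists R2, #|Q1 :&: Q2|; split=> //.
    by move: cE QQ QM; rewrite cR1; clear; lia.
  move: leU leV cE sle ZW QQ ZWQ QM cM; rewrite cR1 shR1.
  move: #|U| #|V| #|Z| #|W| #|M| #|layer T h| #|layer T h.+2| #|Q1| #|Q2| #|R2|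
    #|shadow _| #|shadow _| #|shadow _| #|Z :|: W| #|Z :&: W| #|Q1 :|: Q2| #|Q1 :&: Q2|.
  by clear; lia.
have cR2 : #|R2| = 0 by rewrite e cards0.
exists set0, #|Q1 :&: Q2|; split; rewrite ?sub0set ?cards0 // shadow0 cards0.
move: (excess_le_layer R1M) leU leV cE sle ZW QQ ZWQ QM cM; rewrite cR2.
move: #|U| #|V| #|Z| #|W| #|M| #|layer T h| #|layer T h.+2| #|Q1| #|Q2| #|R1|.
move: #|shadow _| #|shadow _| #|shadow _| #|shadow _| #|Z :|: W| #|Z :&: W| #|Q1 :|: Q2| #|Q1 :&: Q2|.
by clear; lia.
Qed.

(** Large members are pushed down and small ones up towards the middle, and [four_families] applies;
    the Kruskal-Katona theorem then bounds the shadow of [R]. *)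
Lemma card_two_antichains A C : antichain A -> antichain C ->
  (forall X Y, X \in A -> Y \in C -> X \subset Y -> X = Y) ->
  exists2 j, j <= #|A :&: C| &
    #|A| + #|C| + kk h.+1 j <= #|M| + #|layer T h.+2| + j.
Proof.
move=> Aa Ca AC.
have [] := @four_families (downs A h.+2) (downs (co C) h.+2)
    (co (downs (co A) h.+1)) (downs C h.+1).
- by apply/subsetP => X; rewrite !inE => /andP[].
- by apply/subsetP => X; rewrite !inE => /andP[].
- apply: (@co_layer _ h.+1); first by lia.
  by apply/subsetP => X; rewrite !inE => /andP[].
- by apply/subsetP => X; rewrite !inE => /andP[].
- apply/pred0Pn => -[X /= /andP[]]; rewrite !inE => /andP[_ /exists_inP[Y]].
  rewrite inE => YA XY /existsP[x /andP[xX]]; rewrite inE => /andP[_ /exists_inP[X' X'A]].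
  rewrite subUset sub1set => /andP[xX' XX'].
  have YX : ~: Y \subset X by rewrite -setCS setCK.
  have E := Aa _ _ YA X'A (subset_trans YX XX').
  by move: xX'; rewrite -E => /(subsetP YX); rewrite (negbTE xX).
- apply/pred0Pn => -[X /= /andP[]]; rewrite !inE => /andP[_ /exists_inP[Y YC XY]].
  move=> /existsP[x /andP[xX]]; rewrite inE => /andP[_ /exists_inP[X']].
  rewrite inE subUset sub1set => X'C /andP[xX' XX'].
  have YX : ~: X' \subset ~: X by rewrite setCS.
  have E := Ca _ _ X'C YC (subset_trans YX XY).
  have : x \in Y by apply: (subsetP XY); rewrite inE.
  by rewrite -E inE xX'.
move=> R [RM Rle le].
(* A common set of [Z] and [W] lies between a member of [A] and a member of [C]; these are equal, so
   it is both. *)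
have Rle' : #|R| <= #|A :&: C|.
  apply: leq_trans Rle _; apply/subset_leq_card/subsetP => X.
  rewrite !inE => /andP[/andP[_ /exists_inP[Y]]]; rewrite inE => YA XY.
  case/andP=> _ /exists_inP[Z ZC XZ].
  have YX : ~: Y \subset X by rewrite -setCS setCK.
  have E := AC _ _ YA ZC (subset_trans YX XZ).
  have XE : X = Z by apply/eqP; rewrite eqEsubset XZ -E.
  by rewrite {1}XE -E YA XE.
exists #|R| => //.
have KK := kruskal_katona RM.
have split_card (F : {set {set T}}) : antichain F ->
    #|F| <= #|downs F h.+2| + #|downs (co F) h.+1|.
  move=> Fa; rewrite -(cardsID [set X : {set T} | h.+2 <= #|X|] F); apply: leq_add.
    apply: leq_trans (leq_card_downs Fa _); last by lia.
    by apply/subset_leq_card/subsetP => X; rewrite !inE.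
  apply: leq_trans (leq_card_downs (antichain_co Fa) _); last by lia.
  rewrite -(card_co (F :\: _)); apply/subset_leq_card/subsetP => X; rewrite !inE.
  by case/andP=> h1 ->; have := cardsC X; lia.
have := split_card A Aa; have := split_card _ (antichain_co Ca).
by rewrite coK !card_co in le *; lia.
Qed.

(** Swapping the lower ends [P] with the upper ends [Q] preserves the total size and turns every
    inclusion into an equality. *)
Lemma card_two_antichains_matching A C k : antichain A -> antichain C ->
  (forall X X' Y, X \in A -> X' \in A -> Y \in C -> X \subset Y -> X' \subset Y -> X = X') ->
  (forall X Y Y', X \in A -> Y \in C -> Y' \in C -> X \subset Y -> X \subset Y' -> Y = Y') ->
  #|[set X in A | [exists Y in C, X \subset Y]]| <= k ->
  exists2 j, j <= k &
    #|A| + #|C| + kk h.+1 j <= #|M| + #|layer T h.+2| + j.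
Proof.
move=> Aa Ca mA mC; set P := [set X in A | _]; move=> Pk.
pose Q := [set Y in C | [exists X in A, X \subset Y]].
have PP X : reflect (X \in A /\ exists2 Y, Y \in C & X \subset Y) (X \in P).
  by rewrite inE; apply: (iffP andP) => -[XA /exists_inP g]; split.
have QP Y : reflect (Y \in C /\ exists2 X, X \in A & X \subset Y) (Y \in Q).
  by rewrite inE; apply: (iffP andP) => -[XA /exists_inP g]; split.
have PA : P \subset A by apply/subsetP => X /PP[].
have QC : Q \subset C by apply/subsetP => X /QP[].
pose A' := (A :\: P) :|: Q; pose C' := (C :\: Q) :|: P.
have A'P X : X \in A' -> (X \in A /\ X \notin P) \/ X \in Q.
  by rewrite in_setU in_setD => /orP[/andP[-> ->]|->]; [left|right].
have C'P X : X \in C' -> (X \in C /\ X \notin Q) \/ X \in P.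
  by rewrite in_setU in_setD => /orP[/andP[-> ->]|->]; [left|right].
have A'a : antichain A'.
  move=> X Y /A'P[[XA XP]|/QP[XC [X1 X1A XX1]]] /A'P[[YA YP]|/QP[YC [Y1 Y1A YY1]]] XY.
  - exact: Aa.
  - by case/negP: XP; apply/PP; split=> //; exists Y.
  - have E := Aa _ _ X1A YA (subset_trans XX1 XY).
    by apply/eqP; rewrite eqEsubset XY -E.
  - exact: Ca.
have C'a : antichain C'.
  move=> X Y /C'P[[XA XP]|/PP[XC [X1 X1A XX1]]] /C'P[[YA YP]|/PP[YC [Y1 Y1A YY1]]] XY.
  - exact: Ca.
  - have E := Ca _ _ XA Y1A (subset_trans XY YY1).
    by apply/eqP; rewrite eqEsubset XY E.
  - by case/negP: YP; apply/QP; split=> //; exists X.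
  - exact: Aa.
have A'C' X Y : X \in A' -> Y \in C' -> X \subset Y -> X = Y.
  move=> /A'P[[XA XP]|/QP[XC [X1 X1A XX1]]] /C'P[[YC YQ]|/PP[YA [Y1 Y1C YY1]]] XY.
  - by case/negP: XP; apply/PP; split=> //; exists Y.
  - exact: Aa.
  - exact: Ca.
  (* [X1] and [Y] are members of [A] inside the same [Y1], hence equal, and [X] is squeezed between
     them. *)
  have E := mA _ _ _ X1A YA Y1C (subset_trans (subset_trans XX1 XY) YY1) YY1.
  by apply/eqP; rewrite eqEsubset XY -E.
have [j jle le] := card_two_antichains A'a C'a A'C'.
have A'c : #|A'| + #|P| = #|A| + #|Q|.
  rewrite cardsU (eqP (_ : _ :&: _ == set0)) ?cards0 ?subn0; last first.
    rewrite setI_eq0; apply/pred0Pn => -[X /= /andP[]]; rewrite inE => /andP[XP XA] /QP[XC _].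
    by case/negP: XP; apply/PP; split=> //; exists X.
  by have := cardsID P A; have /setIidPr -> := PA; lia.
have C'c : #|C'| + #|Q| = #|C| + #|P|.
  rewrite cardsU (eqP (_ : _ :&: _ == set0)) ?cards0 ?subn0; last first.
    rewrite setI_eq0; apply/pred0Pn => -[X /= /andP[]]; rewrite inE => /andP[XQ XC] /PP[XA _].
    by case/negP: XQ; apply/QP; split=> //; exists X.
  by have := cardsID Q C; have /setIidPr -> := QC; lia.
exists j; last by lia.
apply: leq_trans jle _; apply: leq_trans Pk; apply/subset_leq_card/subsetP => X.
rewrite in_setI => /andP[/A'P[[XA XP]|/QP[XC [X1 X1A XX1]]] /C'P[[YC YQ]|//]].
  by case/negP: XP; apply/PP; split=> //; exists X.
by case/negP: YQ; apply/QP; split=> //; exists X1.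
Qed.

End TwoAntichains.

(** * The extremal families *)

Lemma shadeE n r (F : {set {set 'I_n}}) : F \subset layer 'I_n r ->
  shade r F = co (shadow (co F)).
Proof.
move/subsetP=> FL; apply/setP => Y; rewrite !inE; apply/andP/existsP.
  case=> /eqP Yr /exists_inP[X XF XY]; have := FL X XF; rewrite inE => /eqP Xr.
  have /card_gt0P[x] : 0 < #|Y :\: X|.
    by have := cardsID X Y; have /setIidPr -> := XY; lia.
  rewrite inE => /andP[xX xY]; exists x; rewrite !inE negbK xY /= setCU setCK.
  suff <- : X = ~: [set x] :&: Y by [].
  apply/eqP; rewrite setIC -setDE eqEcard subsetD XY disjoint_sym disjoints1 xX /=.
  by move: (cardsD1 x Y); rewrite xY Yr Xr add1n => -[->].
case=> x /andP[]; rewrite !inE negbK setCU setCK setIC -setDE => xY YF; split.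
  by have := FL _ YF; rewrite inE (cardsD1 x Y) xY.
by apply/exists_inP; exists (Y :\ x) => //; apply: subsetDl.
Qed.

Lemma last_rsubsets_layer n r m : last_rsubsets n r m \subset layer 'I_n r.
Proof. by apply/subsetP => X; rewrite inE => /andP[]. Qed.

(** Complementation reverses squashed order and exchanges [r]-sets with [s]-sets. *)
Lemma co_last_rsubsets n r s m : r + s = n ->
  co (last_rsubsets n r m) = first_sets n s m.
Proof.
move=> rs; apply/setP => X; rewrite !inE; congr andb.
  by have := cardsC X; rewrite card_ord => cX; apply/eqP/eqP; lia.
congr (_ < _); rewrite -[LHS]card_co; apply: eq_card => Y.
rewrite !inE squashed_ltC squashed_ltE; congr andb.
by have := cardsC Y; rewrite card_ord => cY; apply/eqP/eqP; lia.
Qed.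

(** Two [h]-sets are disjoint only if complementary, and no [h]-set is disjoint from an [h.+1]-set.
    Listing [L] first, and its complements first in the same order, puts all disjoint pairs on the
    diagonal. *)
Lemma disjoint_only_extremal n (L D : {set {set 'I_n}}) h k :
  h.*2 = n -> L \subset layer 'I_n h -> D \subset layer 'I_n h.+1 -> #|L| <= k ->
  disjoint_only_on_diagonal k (layer 'I_n h) (L :|: D).
Proof.
move=> hn LL DL Lk; pose cL := [seq ~: X | X <- enum L].
have memcL X : (X \in cL) = (X \in co L).
  rewrite inE; apply/mapP/idP => [[Y]|XL]; first by rewrite mem_enum => YL ->; rewrite setCK.
  by exists (~: X); rewrite ?mem_enum ?setCK.
have coLL : co L \subset layer 'I_n h by apply: co_layer LL; rewrite card_ord; lia.
exists (cL ++ enum (layer 'I_n h :\: co L)), (enum L ++ enum (D :\: L)); split.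
- rewrite cat_uniq map_inj_uniq ?enum_uniq ?andbT //; last exact: setC_inj.
  by apply/hasPn => X; rewrite mem_enum memcL inE => /andP[].
- move=> X; rewrite mem_cat memcL mem_enum in_setD.
  by case: (boolP (X \in co L)) => [/(subsetP coLL) ->|].
- rewrite cat_uniq !enum_uniq andbT /=.
  by apply/hasPn => X; rewrite !mem_enum inE => /andP[].
- by move=> X; rewrite mem_cat !mem_enum in_setD in_setU; case: (X \in L).
have scL : size cL = size (enum L) by rewrite size_map.
have cLE : size (enum L) = #|L| by rewrite -cardE.
have disjC (X Y : {set 'I_n}) : #|X| = h -> [disjoint X & Y] -> #|Y| = h -> Y = ~: X.
  move=> Xh XY Yh; apply/eqP; rewrite eqEcard -disjoints_subset disjoint_sym XY.
  by have := cardsC X; rewrite card_ord; lia.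
move=> i j iA jB; set X := nth _ _ i; set Y := nth _ _ j => XY.
have Xh : #|X| = h.
  have : X \in cL ++ enum (layer 'I_n h :\: co L) by apply: mem_nth.
  by rewrite mem_cat memcL mem_enum => /orP[/(subsetP coLL)|/setDP[+ _]]; rewrite inE => /eqP.
have jL : j < size (enum L).
  rewrite ltnNge; apply/negP => Lj.
  have : Y \in enum (D :\: L).
    by rewrite /Y nth_cat ltnNge Lj; apply: mem_nth; rewrite ltn_subLR // -size_cat.
  rewrite mem_enum in_setD => /andP[_ /(subsetP DL)]; rewrite inE => /eqP Yh.
  have : Y \subset ~: X by rewrite -disjoints_subset disjoint_sym.
  by move/subset_leq_card; have := cardsC X; rewrite card_ord; lia.
have YE : Y = nth set0 (enum L) j by rewrite /Y nth_cat jL.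
have YL : Y \in L by rewrite YE -mem_enum mem_nth.
have := disjC X Y Xh XY; have := subsetP LL Y YL; rewrite inE => /eqP -> /(_ erefl) E.
suff ij : i = j by split=> //; rewrite ij; lia.
(* [X] is also the [j]-th entry of its list, which has no repetitions. *)
have XE : X = nth set0 (cL ++ enum (layer 'I_n h :\: co L)) j.
  by rewrite nth_cat scL jL (nth_map set0) // -YE E setCK.
apply/eqP; rewrite -(nth_uniq set0 iA _ _) -?/X ?XE //.
  by rewrite size_cat scL; lia.
rewrite cat_uniq map_inj_uniq ?enum_uniq ?andbT //; last exact: setC_inj.
by apply/hasPn => Z; rewrite mem_enum memcL inE => /andP[].
Qed.

Lemma antichain_layer (T : finType) r : antichain (layer T r).
Proof.
move=> X Y; rewrite !inE => /eqP Xr /eqP Yr XY.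
by apply/eqP; rewrite eqEcard XY Xr Yr leqnn.
Qed.

Lemma antichain_extremal n r (L : {set {set 'I_n}}) : L \subset layer 'I_n r ->
  antichain (L :|: (layer 'I_n r.+1 :\: shade r L)).
Proof.
move=> LL X Y; rewrite !in_setU !in_setD => /orP[XL|/andP[_ XL]] /orP[YL|/andP[Ys YL]] XY.
- by apply: (@antichain_layer _ r); rewrite ?(subsetP LL).
- case/negP: Ys; rewrite inE; move: YL; rewrite inE => -> /=.
  by apply/exists_inP; exists X.
- have := subset_leq_card XY; have := subsetP LL Y YL; move: XL; rewrite !inE.
  by move=> /eqP -> /eqP ->; rewrite ltnn.
- exact: (@antichain_layer _ r.+1).
Qed.

Lemma card_extremal n h m : h.+1.*2 = n -> m <= 'C(n, h.+1) ->
  #|last_rsubsets n h.+1 m :|: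
     (rsubsets n h.+2 :\: shade h.+1 (last_rsubsets n h.+1 m))| + kk h.+1 m
  = 'C(n, h.+2) + m.
Proof.
move=> hn mn; set L := last_rsubsets _ _ _.
have LL : L \subset layer 'I_n h.+1 := last_rsubsets_layer n h.+1 m.
have coL : co L = first_sets n h.+1 m by apply: co_last_rsubsets; lia.
have shL : shade h.+1 L \subset layer 'I_n h.+2.
  by apply/subsetP => X; rewrite !inE => /andP[].
have csh : #|shade h.+1 L| = kk h.+1 m by rewrite shadeE // card_co coL card_shadow_first_sets.
have cL : #|L| = m by rewrite -card_co coL card_first_sets.
rewrite cardsU (eqP (_ : _ :&: _ == set0)) ?cards0 ?subn0; last first.
  rewrite setI_eq0; apply/pred0Pn => -[X /= /andP[/(subsetP LL)]].
  by rewrite !inE => /eqP ->; rewrite ltn_eqF ?andbF.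
have := cardsID (shade h.+1 L) (layer 'I_n h.+2); have /setIidPr -> := shL.
by rewrite csh card_layer card_ord cL => <-; rewrite addnC (addnC m) addnA.
Qed.

(** * The sign of the Kruskal-Katona function *)

(** So many sets fit into a ground set of [h.*2.+1] points, where [leq_card_shadow] applies. *)
Lemma leq_kk_low h m : m <= 'C(h.*2.+1, h.+1) -> m <= kk h.+1 m.
Proof.
move=> mh; have := leq_card_shadow (first_sets_layer h.*2.+1 h.+1 m).
by rewrite card_first_sets // card_shadow_first_sets // card_ord; apply.
Qed.

(** This is an [h]-binomial representation with $a_i = 2i-1$; since
    $\binom{2i-1}{i}=\binom{2i-1}{i-1}$, [kappa] vanishes at this value. *)
Definition central_sum h := \sum_(1 <= i < h.+1) 'C(2 * i - 1, i).

Lemma central_sumS h : central_sum h.+1 = 'C(h.*2.+1, h.+1) + central_sum h.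
Proof.
rewrite /central_sum big_nat_recr //= addnC; congr ('C(_, _) + _); lia.
Qed.

Lemma bin_central h : 'C(h.*2.+1, h.+1) = 'C(h.*2.+1, h).
Proof. by rewrite -bin_sub; [congr 'C(_, _); lia | lia]. Qed.

Lemma kk_central h x : x <= 'C(h.*2.+1, h) ->
  kk h.+1 ('C(h.*2.+1, h.+1) + x) = 'C(h.*2.+1, h.+1) + kk h x.
Proof.
move=> xh; have b0 : 0 < 'C(h.*2.+1, h.+1) by rewrite bin_gt0; lia.
by rewrite kk_cascade ?bin_central //; move: b0; rewrite bin_central; lia.
Qed.

Lemma central_sum_lt h : 0 < h -> central_sum h < 'C(h.*2.+1, h).
Proof.
elim: h => // -[|h] IH _; first by rewrite central_sumS /central_sum big_nil.
rewrite central_sumS; have := IH isT.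
have : 'C(h.+2.*2, h.+2) <= 'C(h.+2.*2.+1, h.+2) by rewrite leq_bin2l.
rewrite [h.+2.*2]doubleS [X in X <= _]binS => bin_le sum_lt.
by apply: leq_trans bin_le; rewrite -addnS leq_add2l.
Qed.

(** The leading term contributes equally to [m] and to [kk], so it can be peeled off; values not
    exceeding it fall under [leq_kk_low]. *)
Lemma leq_kk_central h m : m <= central_sum h -> m <= kk h m.
Proof.
elim: h m => [|h IH] m; first by rewrite /central_sum big_nil leqn0 => /eqP ->.
rewrite central_sumS => mh; have [|mb] := leqP m 'C(h.*2.+1, h.+1); first exact: leq_kk_low.
have [x mE] : exists x, m = 'C(h.*2.+1, h.+1) + x.
  by exists (m - 'C(h.*2.+1, h.+1)); rewrite subnKC // ltnW.
have h0 : 0 < h.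
  by case: (h) mb mh => //; rewrite /central_sum big_nil; lia.
have xh : x <= central_sum h by move: mh; rewrite mE leq_add2l.
rewrite mE kk_central ?leq_add2l; first exact: IH.
by rewrite ltnW // (leq_ltn_trans xh) // central_sum_lt.
Qed.

(** Once all terms are peeled off, one unit remains at level 0, where [kk] is zero. *)
Lemma kk_central_lt h : kk h.+1 (central_sum h.+1).+1 <= central_sum h.+1.
Proof.
elim: h => [|h IH]; rewrite central_sumS -addnS.
  by rewrite /central_sum big_nil kk_central ?kk0n ?addn0.
by rewrite kk_central ?central_sum_lt // leq_add2l.
Qed.

Local Open Scope ring_scope.

(** * The functions [kappa] and [kappa_star], and the final assembly *)

Lemma kappaE r m : kappa r m = (kk r m)%:Z - m%:Z.
Proof. by []. Qed.

Lemma kappa0 r : kappa r 0 = 0.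
Proof. by rewrite kappaE kkn0. Qed.

Lemma kappa_star_le r k j : (j <= k)%N -> kappa_star r k <= kappa r j.
Proof.
move=> jk; exact: (@bigmin_le_cond _ _ _ _ (Ordinal (jk : (j < k.+1)%N)) predT (fun i : 'I_k.+1 => kappa r i)).
Qed.

Lemma kappa_star_eq0 r k :
  (forall j, (j <= k)%N -> (j <= kk r j)%N) -> kappa_star r k = 0.
Proof.
move=> hk; apply/eqP; rewrite eq_le -{1}(kappa0 r) kappa_star_le //=.
rewrite /kappa_star; elim/big_ind: _ => [|x y x0 y0|i _].
- by rewrite kappa0.
- by rewrite le_min x0.
by rewrite kappaE subr_ge0 lez_nat hk // -ltnS.
Qed.

Theorem theorem2p5 (n : nat) (n_ge4 : (4 <= n)%N) (n_even : ~~ odd n) :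
  [/\ (* the inequality *)
      forall (A B : {set {set 'I_n}}) (k : nat),
        antichain A -> antichain B ->
        (k <= minn #|A| #|B|)%N ->
        disjoint_only_on_diagonal k A B ->
        (#|A| + #|B|)%N%:Z <=
          ('C(n, n./2) + 'C(n, n./2.+1))%N%:Z - kappa_star n./2 k,
      (* the sign of kappa^* *)
      forall k : nat,
        ((k < 1 + \sum_(1 <= i < n./2.+1) 'C(2 * i - 1, i))%N ->
           kappa_star n./2 k = 0) /\
        ((1 + \sum_(1 <= i < n./2.+1) 'C(2 * i - 1, i) <= k)%N ->
           kappa_star n./2 k < 0),
      (* case (i) *)
      forall (A B : {set {set 'I_n}}) (k : nat),
        (k <= minn #|A| #|B|)%N ->
        (k < 1 + \sum_(1 <= i < n./2.+1) 'C(2 * i - 1, i))%N ->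
        A = rsubsets n n./2 ->
        B = rsubsets n n./2.+1 ->
        [/\ antichain A, antichain B, disjoint_only_on_diagonal k A B
          & (#|A| + #|B|)%N%:Z =
              ('C(n, n./2) + 'C(n, n./2.+1))%N%:Z - kappa_star n./2 k]
    & (* case (ii) *)
      forall (A B : {set {set 'I_n}}) (k m : nat),
        (k <= minn #|A| #|B|)%N ->
        (1 + \sum_(1 <= i < n./2.+1) 'C(2 * i - 1, i) <= k)%N ->
        (m <= k)%N ->
        kappa_star n./2 k = kappa n./2 m ->
        A = rsubsets n n./2 ->
        B = last_rsubsets n n./2 m :|:
              (rsubsets n n./2.+1 :\: shade n./2 (last_rsubsets n n./2 m)) ->
        [/\ antichain A, antichain B, disjoint_only_on_diagonal k A B
          & (#|A| + #|B|)%N%:Z =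
              ('C(n, n./2) + 'C(n, n./2.+1))%N%:Z - kappa_star n./2 k]].
Proof.
have [h hn] : exists h, h.+1.*2 = n by exists n./2.-1; lia.
have -> : n./2 = h.+1 by lia.
have star0 k : (k < 1 + \sum_(1 <= i < h.+2) 'C(2 * i - 1, i))%N -> kappa_star h.+1 k = 0.
  rewrite -/(central_sum h.+1) => kh; apply: kappa_star_eq0 => j jk.
  by apply: leq_kk_central; lia.
(* Both equality cases at once; case (i) is [m = 0]. *)
have extremal (A B : {set {set 'I_n}}) (k m : nat) : (k <= minn #|A| #|B|)%N ->
    (m <= k)%N -> kappa_star h.+1 k = kappa h.+1 m -> A = rsubsets n h.+1 ->
    B = last_rsubsets n h.+1 m :|:
          (rsubsets n h.+2 :\: shade h.+1 (last_rsubsets n h.+1 m)) ->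
    [/\ antichain A, antichain B, disjoint_only_on_diagonal k A B
      & (#|A| + #|B|)%N%:Z = ('C(n, h.+1) + 'C(n, h.+2))%N%:Z - kappa_star h.+1 k].
  move=> kAB mk -> AE BE.
  have cA : #|A| = 'C(n, h.+1) by rewrite AE card_layer card_ord.
  have mn : (m <= 'C(n, h.+1))%N by lia.
  have cB := card_extremal hn mn; rewrite -BE in cB.
  split; last by rewrite kappaE; lia.
  - by rewrite AE; apply: antichain_layer.
  - by rewrite BE; apply: antichain_extremal (last_rsubsets_layer n h.+1 m).
  rewrite AE BE; apply: disjoint_only_extremal => //; first exact: last_rsubsets_layer.
    exact: subsetDl.
  by rewrite -card_co (@co_last_rsubsets _ _ h.+1) ?card_first_sets //; lia.
split=> [A B k Aa Ba _ [sA [sB [uA eA uB eB AB]]]|k|A B k kAB kh AE BE|A B k m kAB _].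
- have diag X Y : X \in A -> Y \in B -> [disjoint X & Y] ->
      index X sA = index Y sB /\ (index X sA < k)%N.
    move=> XA YB XY; apply: AB; rewrite ?index_mem ?eA ?eB //.
    by rewrite !nth_index ?eA ?eB.
  have cardT : #|'I_n| = h.+1.*2 by rewrite card_ord.
  have dis (X Y : {set 'I_n}) : X \subset Y -> [disjoint X & ~: Y].
    by rewrite disjoints_subset setCK.
  have [|||j jk] := @card_two_antichains_matching _ h cardT A (co B) k Aa (antichain_co Ba).
  + move=> X X' Y XA X'A; rewrite inE => YB /dis/(diag _ _ XA YB)[e _].
    move=> /dis/(diag _ _ X'A YB)[e' _]; have XsA : X \in sA by rewrite eA.
    by rewrite -(nth_index set0 XsA) e -e' nth_index // eA.
  + move=> X Y Y' XA; rewrite !inE => YB Y'B /dis/(diag _ _ XA YB)[e _].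
    move=> /dis/(diag _ _ XA Y'B)[e' _]; apply: (@setC_inj 'I_n).
    have YsB : ~: Y \in sB by rewrite eB.
    by rewrite -(nth_index set0 YsB) -e e' nth_index // eB.
  (* All lower ends of inclusions occur among the first [k] entries of [sA]. *)
  + apply: (@leq_trans (size (take k sA))); last by rewrite size_take_min geq_minl.
    apply: leq_trans (card_size _); apply/subset_leq_card/subsetP => X.
    rewrite inE => /andP[XA /exists_inP[Y]]; rewrite inE => YB /dis/(diag _ _ XA YB)[_].
    by rewrite in_take ?eA.
  rewrite !card_layer card_co card_ord => le.
  move: le (kappa_star_le h.+1 jk); rewrite kappaE.
  move: (kappa_star _ _) (kk _ _) #|A| #|B| 'C(n, h.+1) 'C(n, h.+2); clear; lia.
- split=> [|kh]; first exact: star0.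
  apply: le_lt_trans (kappa_star_le h.+1 kh) _.
  by have := kk_central_lt h; rewrite kappaE -/(central_sum h.+1) add1n; lia.
- apply: (extremal _ _ _ 0%N) => //; first by rewrite kappa0 star0.
  have -> : last_rsubsets n h.+1 0 = set0.
    by apply/setP => X; rewrite !inE ltn0 andbF.
  rewrite set0U BE; apply/setP => X; rewrite in_setD [X in ~~ X](_ : _ = false) //.
  by rewrite inE; apply/andP => -[_ /exists_inP[Y]]; rewrite inE.
- exact: extremal.
Qed.
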